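(* Let $H$ be an inner product space over $\mathbb{F}$, let $G\subset H$ be an isometry-invariant open set with $0\notin G$, let $R_2=\{\|g\|^2:g\in G\}$, and let $\sigma:G\times H\times H\to\mathbb{F}$ be such that $\sigma_g$ is a conjugate-symmetric sesquilinear form on $H$ for every $g\in G$. Then $\sigma$ is isometry-invariant if and only if there are (unique) functions $\varphi,\psi:R_2\to\mathbb{R}$ such that $$\sigma_g(f,h)=\varphi(\|g\|^2)\langle f,h\rangle+\psi(\|g\|^2)\langle f,g\rangle\langle g,h\rangle\quad\text{for all } g\in G,\ f,h\in H.$$ Moreover, in this case the following hold: (i) for $r\in R_2$, $\sigma_g$ is positive definite for some (equivalently, every) $g\in\sqrt{r}S$ if and only if $\varphi(r)>0$ and $\varphi(r)+r\psi(r)>0$; (ii) the degree of smoothness of $\sigma$ coincides with the minimal degree of smoothness of $\varphi$ and $\psi$.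
   Context: $\mathbb{F}$ is $\mathbb{R}$ or $\mathbb{C}$; $H$ may be finite- or infinite-dimensional. $S$ is the unit sphere of $H$. For $\mathbb{F}=\mathbb{R}$, sesquilinear means bilinear; for $\mathbb{F}=\mathbb{C}$, the inner product and sesquilinear forms are linear in the first and conjugate-linear in the second argument. An isometry is an $\mathbb{F}$-linear map $H\to H$ preserving the inner product (not necessarily surjective). A set $G\subset H$ is isometry-invariant if $TG\subset G$ for every isometry $T$. $\sigma$ is isometry-invariant if $\sigma_{Tg}(Tf,Th)=\sigma_g(f,h)$ for all isometries $T$ and all $g\in G$, $f,h\in H$. No continuity or smoothness of $\sigma$ is assumed in advance.
   Formalization: If dim H = 1, φ and ψ are not unique, and (i), (ii) can fail (e.g. σ=⟨·,·⟩, φ=−1, ψ(r)=2/r); so uniqueness, and (i), (ii) for every such pair, are stated for dim H ≠ 1, while the equivalence and existence of a pair satisfying (i), (ii) are stated in every dimension. *)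

(* Defs.v *)
From HB Require Import structures.
From mathcomp Require Import all_boot all_order all_algebra.
From mathcomp Require Import sesquilinear complex.
From mathcomp Require Import all_classical all_reals all_analysis.
From mathcomp Require Import ring lra.

Set Implicit Arguments.
Unset Strict Implicit.
Unset Printing Implicit Defensive.
Import Order.TTheory GRing.Theory Num.Theory.
Import numFieldNormedType.Exports.
Local Open Scope ring_scope.
Local Open Scope classical_set_scope.

Variant scalar_kind := RealScalars | ComplexScalars.

Section Scalars.
Context (R : realType).

Definition scalar_field (c : scalar_kind) : numFieldType :=
  match c with RealScalars => R | ComplexScalars => R[i] end.

Definition sconj (c : scalar_kind) : scalar_field c -> scalar_field c :=
  match c with RealScalars => id | ComplexScalars => @conjc R end.

Definition sRe (c : scalar_kind) : scalar_field c -> R :=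
  match c with RealScalars => id | ComplexScalars => @complex.Re R end.

Definition of_real (c : scalar_kind) : R -> scalar_field c :=
  match c with
  | RealScalars => id
  | ComplexScalars => fun x => Complex x 0
  end.

Context (c : scalar_kind).

Lemma of_real_zmod : zmod_morphism (@of_real c).
Proof. by case: c => //= x y; exact: (rmorphB (real_complex R)). Qed.
Lemma of_real_monoid : monoid_morphism (@of_real c).
Proof.
by case: c => //=; split=> // x y; exact: (rmorphM (real_complex R)).
Qed.
HB.instance Definition _ :=
  GRing.isZmodMorphism.Build R (scalar_field c) (@of_real c) of_real_zmod.
HB.instance Definition _ :=
  GRing.isMonoidMorphism.Build R (scalar_field c) (@of_real c) of_real_monoid.

Lemma sconj_zmod : zmod_morphism (@sconj c).
Proof. by case: c => //= x y; rewrite rmorphB. Qed.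
Lemma sconj_monoid : monoid_morphism (@sconj c).
Proof. by case: c => //=; split=> [|x y]; rewrite ?rmorph1 ?rmorphM. Qed.
HB.instance Definition _ :=
  GRing.isZmodMorphism.Build (scalar_field c) (scalar_field c) (@sconj c) sconj_zmod.
HB.instance Definition _ :=
  GRing.isMonoidMorphism.Build (scalar_field c) (scalar_field c) (@sconj c) sconj_monoid.

Lemma sconjK : involutive (@sconj c).
Proof. by case: c => //=; exact: conjcK. Qed.

Lemma sRe_zmod : zmod_morphism (@sRe c).
Proof. by case: c => //= -[x1 x2] [y1 y2]. Qed.
HB.instance Definition _ :=
  GRing.isZmodMorphism.Build (scalar_field c) R (@sRe c) sRe_zmod.

Lemma sReZ (a : R) (z : scalar_field c) : sRe (of_real c a * z) = a * sRe z.
Proof. by case: c z => //= -[x y] /=; rewrite mul0r subr0. Qed.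

Lemma sRe_conj (z : scalar_field c) : sRe (sconj z) = sRe z.
Proof. by case: c z => //= -[]. Qed.

Lemma sconj_real (a : R) : sconj (of_real c a) = of_real c a.
Proof. by case: c => //=; rewrite oppr0. Qed.

Lemma sRe_gt0 (z : scalar_field c) : 0 < z -> 0 < sRe z.
Proof. by case: c z => //= -[x y]; rewrite ltcE => /andP[]. Qed.

Lemma mul_sconj_gt0 (z : scalar_field c) : z != 0 -> 0 < z * sconj z.
Proof.
case: c z => /= [z z0|z z0]; first by rewrite -expr2 exprn_even_gt0.
by rewrite -sqr_normc exprn_gt0 ?normr_gt0.
Qed.

End Scalars.
Arguments sconj {R c}.
Arguments sRe {R c}.
Arguments of_real {R}.

(* [ip_space ip] is the vector space [H], regarded as a real vector space and
   normed by [`|x| = sqrt (ip x x)]. *)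
Definition ip_space (R : realType) (c : scalar_kind) (H : lmodType (scalar_field R c))
  (ip : {dot H for @sconj R c}) : Type := H.

Section InnerProductSpace.
Context (R : realType) (c : scalar_kind).
Local Notation K := (scalar_field R c).
Context (H : lmodType K) (ip : {dot H for @sconj R c}).

Lemma ipD x y z : ip (x + y) z = ip x z + ip y z.
Proof. exact: linearDl. Qed.
Lemma ipDr x y z : ip z (x + y) = ip z x + ip z y.
Proof. exact: linearDr. Qed.
Lemma ipZ a x z : ip (a *: x) z = a * ip x z.
Proof. exact: linearZl_LR. Qed.
Lemma ipZr a x z : ip z (a *: x) = sconj a * ip z x.
Proof. exact: linearZr_LR. Qed.
Lemma ipC x y : ip x y = sconj (ip y x).
Proof. by rewrite [LHS]hermC expr0 mul1r. Qed.
Lemma ip0 x : ip 0 x = 0.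
Proof. exact: linear0l. Qed.
Lemma ip_gt0 x : x != 0 -> 0 < ip x x.
Proof. exact: neq0_dnorm_gt0. Qed.

Local Notation ip_space := (ip_space ip).
HB.instance Definition _ := GRing.Zmodule.on ip_space.

Definition ip_scale (a : R) (x : ip_space) : ip_space := of_real c a *: (x : H).

Let ip_scaleA a b x : ip_scale a (ip_scale b x) = ip_scale (a * b) x.
Proof. by rewrite /ip_scale scalerA rmorphM. Qed.
Let ip_scale1 : left_id 1 ip_scale.
Proof. by move=> x; rewrite /ip_scale rmorph1 scale1r. Qed.
Let ip_scaleDr : right_distributive ip_scale +%R.
Proof. by move=> a x y; rewrite /ip_scale scalerDr. Qed.
Let ip_scaleDl x : {morph ip_scale^~ x : a b / a + b}.
Proof. by move=> a b; rewrite /ip_scale rmorphD scalerDl. Qed.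

HB.instance Definition _ := GRing.Zmodule_isLmodule.Build R ip_space
  ip_scaleA ip_scale1 ip_scaleDr ip_scaleDl.

Definition ip_norm (x : ip_space) : R := Num.sqrt (sRe (ip x x)).

Let B (x y : H) : R := sRe (ip x y).

Let BC x y : B x y = B y x.
Proof. by rewrite /B ipC sRe_conj. Qed.
Let BD x y z : B (x + y) z = B x z + B y z.
Proof. by rewrite /B ipD raddfD. Qed.
Let BZ a x z : B (of_real c a *: x) z = a * B x z.
Proof. by rewrite /B ipZ sReZ. Qed.
Let B_ge0 x : 0 <= B x x.
Proof.
have [->|x0] := eqVneq x 0; first by rewrite /B ip0 raddf0.
by rewrite ltW// sRe_gt0// ip_gt0.
Qed.
Let B0 x : B x x = 0 -> x = 0.
Proof.
apply: contra_eq => x0; rewrite gt_eqF//; exact/sRe_gt0/ip_gt0.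
Qed.

Let cauchy_schwarz x y : B x y ^+ 2 <= B x x * B y y.
Proof.
have [->|y0] := eqVneq y 0.
  by rewrite BC /B !ip0 raddf0 mulr0 expr0n.
have Byy : 0 < B y y by apply/sRe_gt0/ip_gt0.
have := B_ge0 (of_real c (B y y) *: x + of_real c (- B x y) *: y).
rewrite BD !BZ ![B _ (_ + _)]BC !BD !BZ (BC y x).
set a := B x x; set b := B y y in Byy *; set d := B x y => h.
have {}h : 0 <= b * (a * b - d ^+ 2) by apply: (le_trans h); rewrite le_eqVlt; apply/orP; left; apply/eqP; ring.
by move: h; rewrite pmulr_rge0// subr_ge0.
Qed.

Let ip_normD x y : ip_norm (x + y) <= ip_norm x + ip_norm y.
Proof.
rewrite -(@ler_pXn2r _ 2) ?nnegrE ?addr_ge0 ?sqrtr_ge0//.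
rewrite sqrrD !sqr_sqrtr; [|exact: B_ge0..].
rewrite -/(B _ _) -/(B x x) -/(B y y) BD ![B _ (_ + _)]BC !BD (BC y x).
suff : B x y <= Num.sqrt (B x x) * Num.sqrt (B y y).
  by rewrite /ip_norm -!/(B _ _) mulr2n => h; lra.
rewrite -sqrtrM; last exact: B_ge0.
by rewrite (le_trans (ler_norm _))// -sqrtr_sqr ler_wsqrtr// cauchy_schwarz.
Qed.

Let ip_normZ (a : R) (x : ip_space) : ip_norm (a *: x) = `|a| * ip_norm x.
Proof.
rewrite /ip_norm -!/(B _ _) [in LHS]/GRing.scale/= BZ BC BZ mulrA -expr2.
by rewrite sqrtrM ?sqr_ge0// sqrtr_sqr.
Qed.

Let ip_norm0_eq0 (x : ip_space) : ip_norm x = 0 -> x = 0.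
Proof.
move=> /eqP; rewrite sqrtr_eq0 => h; apply: B0.
by apply/eqP; rewrite eq_le h B_ge0.
Qed.

HB.instance Definition _ :=
  Lmodule_isNormed.Build R ip_space ip_normD ip_normZ ip_norm0_eq0.

Lemma ip_norm_sqr (x : ip_space) : `|x| ^+ 2 = sRe (ip x x).
Proof. by rewrite [`|x|]/(ip_norm x) sqr_sqrtr//; exact: B_ge0. Qed.

End InnerProductSpace.

Section ScalarSpace.
Context (R : realType) (c : scalar_kind).
Local Notation K := (scalar_field R c).

Definition scalar_ip (x y : K^o) : K := x * sconj y.

Let scalar_ip_addl y : zmod_morphism (scalar_ip^~ y).
Proof. by move=> x z; rewrite /scalar_ip mulrBl. Qed.
Let scalar_ip_addr x : zmod_morphism (scalar_ip x).
Proof. by move=> y z; rewrite /scalar_ip rmorphB mulrBr. Qed.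
Let scalar_ipZl y : scalable_for *%R (scalar_ip^~ y).
Proof. by move=> a x; rewrite /scalar_ip -mulrA. Qed.
Let scalar_ipZr x : scalable_for (@sconj R c \; *%R) (scalar_ip x).
Proof. by move=> a y; rewrite /scalar_ip /= rmorphM mulrCA. Qed.
HB.instance Definition _ := isBilinear.Build K K^o K^o K *%R
  (@sconj R c \; *%R) scalar_ip
  scalar_ip_addl scalar_ip_addr scalar_ipZl scalar_ipZr.

Let scalar_ipC x y : scalar_ip x y = (-1) ^+ false * sconj (scalar_ip y x).
Proof. by rewrite /scalar_ip expr0 mul1r rmorphM /= sconjK mulrC. Qed.
HB.instance Definition _ :=
  isHermitianSesquilinear.Build K K^o false (@sconj R c) scalar_ip scalar_ipC.

Let scalar_ip_gt0 x : x != 0 -> 0 < scalar_ip x x.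
Proof. exact: mul_sconj_gt0. Qed.
HB.instance Definition _ :=
  isDotProduct.Build K K^o scalar_ip scalar_ip_gt0.

(* the scalar field as a real normed space, with [`|z| = sqrt (Re (z * conj z))]. *)
Definition scalar_space := ip_space (@scalar_ip : {dot K^o for @sconj R c}).
HB.instance Definition _ := NormedModule.on scalar_space.

End ScalarSpace.

Section BoundedLinear.
Context (R : realType) (E F : normedModType R).

Definition bounded_linear : {pred E -> F} :=
  [pred f | `[< linear f /\ exists M : R, forall x, `|f x| <= M * `|x| >]].

Lemma bounded_linearP (f : E -> F) :
  reflect (linear f /\ exists M : R, forall x, `|f x| <= M * `|x|)
          (f \in bounded_linear).
Proof. exact: asboolP. Qed.

Record blin := BLin {
  blin_fun :> E -> F ;
  blin_funP : blin_fun \in bounded_linear }.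

HB.instance Definition _ := [isSub for blin_fun].
HB.instance Definition _ := [Choice of blin by <:].

Let bounded_linear_submod : submod_closed bounded_linear.
Proof.
split=> [|a f g].
  apply/bounded_linearP; split=> [b x y|]; first by rewrite scaler0 addr0.
  by exists 0 => x; rewrite normr0 mul0r.
move=> /bounded_linearP[flin [M fM]] /bounded_linearP[glin [N gN]].
apply/bounded_linearP; split=> [b x y|].
  rewrite !fctE /= flin glin !scalerDr !scalerA (mulrC a b) -!addrA.
  by congr (_ + _); rewrite addrCA.
exists (`|a| * M + N) => x; rewrite fctE (le_trans (ler_normD _ _))// mulrDl.
by rewrite lerD// normrZ -mulrA ler_wpM2l.
Qed.
HB.instance Definition _ := GRing.isSubmodClosed.Build R (E -> F) bounded_linear
  bounded_linear_submod.
HB.instance Definition _ := [SubChoice_isSubLmodule of blin by <:].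

Lemma blin_linear (f : blin) : linear f.
Proof. by case: f => f /= /bounded_linearP[]. Qed.
HB.instance Definition _ (f : blin) :=
  GRing.isLinear.Build R E F *:%R (blin_fun f) (blin_linear f).

Lemma blinP (f g : blin) : f =1 g -> f = g.
Proof. by move=> fg; apply: val_inj; apply/funext. Qed.

Definition opnorm (f : blin) : R := sup [set `|f x| | x in [set x | `|x| <= 1]].

Let opnorm_has_sup (f : blin) : has_sup [set `|f x| | x in [set x | `|x| <= 1]].
Proof.
split; first by exists `|f 0|, 0 => //=; rewrite normr0.
case: f => f /= /bounded_linearP[_ [M fM]].
exists `|M| => _ [x /= x1 <-]; rewrite (le_trans (fM x))//.
by rewrite (le_trans (ler_norm _))// normrM normr_id ler_piMr.
Qed.

Lemma opnorm_ge0 (f : blin) : 0 <= opnorm f.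
Proof.
apply: (@le_trans _ _ `|f 0|) => //.
by apply: ub_le_sup; [case: (opnorm_has_sup f)|exists 0 => //=; rewrite normr0].
Qed.

Lemma opnormP (f : blin) x : `|f x| <= opnorm f * `|x|.
Proof.
have [->|x0] := eqVneq x 0; first by rewrite linear0 !normr0 mulr0.
have nx0 : 0 < `|x| by rewrite normr_gt0.
rewrite -ler_pdivrMr// mulrC -[X in X * _]gtr0_norm ?invr_gt0// -normrZ.
rewrite -linearZ; apply: ub_le_sup; first by case: (opnorm_has_sup f).
by exists (`|x|^-1 *: x) => //=; rewrite normrZ gtr0_norm ?invr_gt0// mulVf// gt_eqF.
Qed.

Lemma opnorm_le (f : blin) (M : R) :
  0 <= M -> (forall x, `|f x| <= M * `|x|) -> opnorm f <= M.
Proof.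
move=> M0 fM; apply: sup_le_ub => [|_ [x /= x1 <-]].
  by case: (opnorm_has_sup f).
by rewrite (le_trans (fM x))// ler_piMr.
Qed.

Let opnormD (f g : blin) : opnorm (f + g) <= opnorm f + opnorm g.
Proof.
apply: opnorm_le => [|x]; first by rewrite addr_ge0// opnorm_ge0.
by rewrite (le_trans (ler_normD _ _))// mulrDl lerD// opnormP.
Qed.

Let opnormZ_le (a : R) (f : blin) : opnorm (a *: f) <= `|a| * opnorm f.
Proof.
apply: opnorm_le => [|x]; first by rewrite mulr_ge0// opnorm_ge0.
by rewrite normrZ -mulrA ler_wpM2l// opnormP.
Qed.

Let opnormZ (a : R) (f : blin) : opnorm (a *: f) = `|a| * opnorm f.
Proof.
apply/eqP; rewrite eq_le opnormZ_le /=.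
have [->|a0] := eqVneq a 0; first by rewrite normr0 mul0r opnorm_ge0.
rewrite -ler_pdivlMl ?normr_gt0// -normfV.
by rewrite -[in leLHS](scalerK a0 f) opnormZ_le.
Qed.

Let opnorm0_eq0 (f : blin) : opnorm f = 0 -> f = 0.
Proof.
move=> f0; apply: blinP => x; apply/eqP.
by rewrite -normr_le0 (le_trans (opnormP _ _))// f0 mul0r.
Qed.

HB.instance Definition _ :=
  Lmodule_isNormed.Build R blin opnormD opnormZ opnorm0_eq0.

End BoundedLinear.

Section Smoothness.
Context (R : realType).

(* The Frechet derivative as a map into the normed space [blin E F]; its value
   where [f] is not differentiable is irrelevant in [class_C]. *)
Definition frechet (E F : normedModType R) (f : E -> F) (x : E) : blin E F :=
  insubd 0 ('d f x : E -> F).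

Lemma frechetE (E F : normedModType R) (f : E -> F) (x : E) :
  differentiable f x -> frechet f x = 'd f x :> (E -> F).
Proof.
move=> /diff_continuous dfc; rewrite /frechet -[LHS]/(val _) insubdK//.
apply/bounded_linearP; split; first exact: linearP.
have /linear_boundedP : bounded_near ('d f x) (nbhs (0 : E)).
  exact/continuous_linear_bounded/dfc.
by move=> /pinfty_ex_gt0[M _ dfM]; exists M.
Qed.

(* [class_C k U f]: [f] is k times continuously Frechet differentiable (over the
   reals) on the open set [U]. *)
Fixpoint class_C (k : nat) (E F : normedModType R) (U : set E) (f : E -> F) : Prop :=
  match k with
  | 0 => forall x, U x -> {for x, continuous f}
  | k'.+1 => (forall x, U x -> differentiable f x) /\ class_C k' U (frechet f)
  end.

(* The largest [k] such that [f] is of class C^k on the open set [U]; this is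
   [+oo] when [f] is of class C^oo and [-oo] when [f] is not continuous. *)
Definition smoothness (E F : normedModType R) (U : set E) (f : E -> F) : \bar R :=
  ereal_sup [set k%:R%:E | k in [set k : nat | class_C k U f]].

End Smoothness.

Section IsometryInvariance.
Context (R : realType) (c : scalar_kind).
Local Notation K := (scalar_field R c).
Context (H : lmodType K) (ip : {dot H for @sconj R c}).
Implicit Types (G : set (ip_space ip)) (s : H -> H -> K)
  (sigma : H -> H -> H -> K) (phi psi : R -> R).

Definition isometry_invariant_set G : Prop :=
  forall T : {linear H -> H}, isometry ip ip T -> T @` G `<=` G.

Definition isometry_invariant G sigma : Prop :=
  forall T : {linear H -> H}, isometry ip ip T ->
  forall g f h : H, G g -> sigma (T g) (T f) (T h) = sigma g f h.

Definition conj_symmetric_sesquilinear s : Prop :=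
  exists s' : {hermitian_sym H for @sconj R c}, s = s'.

Definition positive_definite s : Prop := forall f : H, f != 0 -> 0 < s f f.

Definition sqr_norms G : set R := [set `|g| ^+ 2 | g in G].

(* The functions [phi] and [psi] only matter on [sqr_norms G], and [sigma] only
   on [G]. *)
Definition represents G sigma phi psi : Prop :=
  forall (g : ip_space ip) (f h : H), G g ->
    sigma g f h = of_real c (phi (`|g| ^+ 2)) * ip f h
                + of_real c (psi (`|g| ^+ 2)) * ip f g * ip g h.

Definition sphere (r : R) : set (ip_space ip) := [set g | `|g| = r].

Definition positivity_criterion G sigma phi psi : Prop :=
  forall r : R, sqr_norms G r ->
    ((exists2 g, sphere (Num.sqrt r) g & positive_definite (sigma g)) <->
       0 < phi r /\ 0 < phi r + r * psi r) /\
    ((forall g, sphere (Num.sqrt r) g -> positive_definite (sigma g)) <->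
       0 < phi r /\ 0 < phi r + r * psi r).

Definition smoothness_criterion G sigma phi psi : Prop :=
  smoothness [set p : ip_space ip * ip_space ip * ip_space ip | G p.1.1]
    (fun p => sigma p.1.1 p.1.2 p.2 : scalar_space R c) =
  mine (smoothness (sqr_norms G) (phi : R -> R^o))
       (smoothness (sqr_norms G) (psi : R -> R^o)).

End IsometryInvariance.

Definition one_dimensional (K : fieldType) (H : lmodType K) : Prop :=
  exists2 e : H, e != 0 & forall x : H, exists a : K, x = a *: e.

(* Main.v *)
Require Import Defs.
From HB Require Import structures.
From mathcomp Require Import all_boot all_order all_algebra.
From mathcomp Require Import sesquilinear complex.
From mathcomp Require Import all_classical all_reals all_analysis.
From mathcomp Require Import ring.

(** Two facts carry the algebraic part. First, any two vectors of equal norm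
    are exchanged by an isometry of [H] that moves only the line of their
    difference ([ex_isometry_mapping]). So [G] is a union of spheres centred
    at [0], and an invariant [sigma] is determined by its values at one
    point of each sphere. Second, [sigma g] is invariant under the
    isometries that fix [g]. Reflections among them force [sigma g] to be
    diagonal along [g] and its orthogonal, and transitivity on the spheres
    of the orthogonal forces it to be a multiple [phi] of the inner product
    there ([stabilizer_form]). The coefficient [psi] accounts for the free
    value on the line of [g]: the eigenvalues of [sigma g] are [phi] on the
    orthogonal of [g] and [phi + r psi] on [g], with [r = `|g| ^+ 2].
    Uniqueness and the positivity criterion are read off from these two
    eigenvalues.

    When [H] is a line the orthogonal is trivial and only [phi + r psi] is
    determined; the representation with [psi = 0] then has the stated
    properties. The condition that [psi] vanishes on [sqr_norms G] if [H] is
    a line is carried through the lemmas, so that both cases share the same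
    proofs.

    For smoothness it is shown that for each [k] the map [sigma] is C^k
    exactly when [phi] and [psi] are ([class_C_represents],
    [represents_class_C]); the degrees are then compared by
    [smoothness_min]. In one direction [sigma] is an expression in [phi],
    [psi] and the inner product. In the other, [phi] and [psi] are recovered
    from the values of [sigma] along the smooth curve [sqrt r *: u] with [u]
    a unit vector. This rests on a calculus of C^k maps between normed
    spaces: closure under bounded bilinear products ([class_C_bilinear]) and
    composition ([class_C_comp]), both by induction on [k] over all target
    spaces, since the derivative takes values in a space of operators. *)

Set Implicit Arguments.
Unset Strict Implicit.
Unset Printing Implicit Defensive.
Import Order.TTheory GRing.Theory Num.Theory.
Import numFieldNormedType.Exports.
Local Open Scope ring_scope.
Local Open Scope classical_set_scope.

(** * Frechet derivatives and bounded bilinear maps *)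

Section FrechetCalculus.
Context (R : realType).
Implicit Types E F W : normedModType R.

(** The derivative depends only on the germ; this is what lets derivatives be
    computed from a formula that is valid on an open set only. *)
Lemma is_diff_near_eq E F (f g df : E -> F) x :
  is_diff x f df -> (\near x, f x = g x) -> is_diff x g df.
Proof.
move=> fdf fg; have fx : differentiable f x by [].
have [dfc /eqaddoP dfx] := (diff_locallyP x f).1 fx.
have gx : g \o shift x = cst (g x) + 'd f x +o_ (0 : E) id.
  apply/eqaddoP => e e0; move: fg; rewrite (near_shift 0) subr0 => fg.
  have gfx : g x = f x by rewrite -[x]add0r -[LHS](nbhs_singleton fg).
  by apply: filterS2 fg (dfx e e0) => y /=; rewrite !fctE /= gfx => ->.
have dg : 'd g x = df :> (E -> F).
  by rewrite -[df](@diff_val _ _ _ _ _ f df fdf); exact: diff_unique.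
have dg' : 'd g x = 'd f x :> (E -> F) by rewrite dg diff_val.
by split; [apply/diff_locallyP; rewrite dg'; split|exact: dg].
Qed.

Lemma is_diff_frechet E F (f df : E -> F) x :
  is_diff x f df -> frechet f x = df :> (E -> F).
Proof. by move=> fdf; rewrite frechetE// diff_val. Qed.

Lemma is_diff_blin E F (f : E -> F) x :
  differentiable f x -> is_diff x f (frechet f x).
Proof. by move=> fx; rewrite frechetE//; exact: differentiableP. Qed.

Lemma continuous_blin E F (f : blin E F) : continuous f.
Proof.
apply: bounded_linear_continuous; apply/linear_boundedP.
exists (opnorm f); split; first exact: num_real.
move=> M fM x; rewrite (le_trans (opnormP _ _))// ler_wpM2r// ltW//.
Qed.

Lemma ex_blin E F (f : E -> F) :
  linear f -> (exists M, forall x, `|f x| <= M * `|x|) ->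
  exists L : blin E F, L = f :> (E -> F).
Proof.
by move=> fl fM; exists (BLin (introT (bounded_linearP f) (conj fl fM))).
Qed.

Lemma ex_id_blin : exists I : blin R R^o, I = id :> (R -> R^o).
Proof. by apply: ex_blin => //; exists 1 => r; rewrite mul1r. Qed.

Lemma blinDE E F (a : R) (L M : blin E F) h : (a *: L + M) h = a *: L h + M h.
Proof. by []. Qed.

(** A boundedness condition instead of a bundled bilinear map: the products
    that arise from differentiating [b] take values in spaces of operators and
    are only obtained through existence lemmas. *)
Definition bounded_bilinear E F W (b : E -> F -> W) :=
  [/\ forall y, linear (b^~ y), forall x, linear (b x) &
      exists M, forall x y, `|b x y| <= M * `|x| * `|y|].

Lemma bounded_bilinear_ge0 E F W (b : E -> F -> W) :
  bounded_bilinear b ->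
  exists2 M, 0 <= M & forall x y, `|b x y| <= M * `|x| * `|y|.
Proof.
case=> _ _ [M bM]; exists `|M| => // x y; rewrite (le_trans (bM x y))//.
by rewrite ler_wpM2r// ler_wpM2r// ler_norm.
Qed.

Lemma bounded_bilinear_diff E F W (b : E -> F -> W) p :
  bounded_bilinear b ->
  is_diff p (fun q => b q.1 q.2) (fun q => b p.1 q.2 + b q.1 p.2).
Proof.
move=> bb; have [M M0 bM] := bounded_bilinear_ge0 bb; case: bb => bl br _.
have bil : bilinear_for (GRing.Scale.Law.clone _ _ *:%R _)
    (GRing.Scale.Law.clone _ _ *:%R _) b.
  by split=> [u|u] a x y /=; [rewrite bl|rewrite br].
pose bM' := bilinear_isBilinear.Build R E F W _ _ b bil.
pose B : {bilinear E -> F -> W} := HB.pack b bM'.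
have Bc : continuous (fun p => B p.1 p.2).
  move=> q; apply/subr_cvg0; apply/norm_cvg0P.
  pose N (p : E * F) : R :=
    M * `|p.1 - q.1| * `|p.2| + M * `|q.1| * `|p.2 - q.2|.
  apply: (@squeeze_cvgr _ _ _ _ (cst 0) N).
  - near=> r; rewrite normr_ge0 /= /N.
    have -> : B r.1 r.2 - B q.1 q.2 = B (r.1 - q.1) r.2 + B q.1 (r.2 - q.2).
      by rewrite linearBl linearBr /= subrKA.
    by rewrite (le_trans (ler_normD _ _))// lerD.
  - exact: cvg_cst.
  - rewrite -[0 in X in _ --> X](_ : N q = 0); last first.
      by rewrite /N !subrr !normr0 !mulr0 mul0r addr0.
    rewrite /N; apply: cvgD; apply: cvgM.
    + apply: cvgM; first exact: cvg_cst.
      by apply: cvg_norm; apply: cvgB; [exact: cvg_fst|exact: cvg_cst].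
    + by apply: cvg_norm; exact: cvg_snd.
    + exact: cvg_cst.
    + by apply: cvg_norm; apply: cvgB; [exact: cvg_snd|exact: cvg_cst].
split; first exact: (differentiable_bilin p Bc).
exact: (diff_bilin p Bc).
Unshelve. all: by end_near. Qed.

Lemma bounded_bilinear_comp_diff (D E F W : normedModType R) (b : E -> F -> W)
    (f df : D -> E) (g dg : D -> F) x :
  bounded_bilinear b -> is_diff x f df -> is_diff x g dg ->
  is_diff x (fun y => b (f y) (g y)) (fun h => b (f x) (dg h) + b (df h) (g x)).
Proof.
move=> bb fx gx; have := bounded_bilinear_diff (f x, g x) bb.
exact: (@is_diff_comp _ _ _ _ (fun y => (f y, g y))).
Qed.
End FrechetCalculus.

(** * Calculus of the classes C^k on open sets *)

Section ClassC.
Context (R : realType).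
Implicit Types D E F W : normedModType R.

Lemma class_C_continuous E F (U : set E) (f : E -> F) k :
  class_C k U f -> forall x, U x -> {for x, continuous f}.
Proof.
by case: k => //= k [df _] x /df; exact: differentiable_continuous.
Qed.

Lemma class_CW k E F (U : set E) (f : E -> F) :
  class_C k.+1 U f -> class_C k U f.
Proof.
elim: k F f => [|k IH] F f fC; first exact: (class_C_continuous fC).
by case: fC => df fC; split=> //; exact: IH.
Qed.

Lemma class_C_sub k E F (U V : set E) (f : E -> F) :
  U `<=` V -> class_C k V f -> class_C k U f.
Proof.
move=> UV; elim: k F f => [|k IH] F f /=; first by move=> fC x /UV; exact: fC.
by move=> [df fC]; split=> [x /UV|]; [exact: df|exact: IH].
Qed.

Lemma class_C_le k l E F (U : set E) (f : E -> F) :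
  (k <= l)%N -> class_C l U f -> class_C k U f.
Proof.
elim: l => [|l IH]; first by case: k.
by rewrite leq_eqVlt => /predU1P[->//|kl /class_CW/IH]; apply.
Qed.

Lemma eq_class_C k E F (U : set E) (f g : E -> F) :
  open U -> (forall x, U x -> f x = g x) -> class_C k U f -> class_C k U g.
Proof.
move=> oU; elim: k F f g => [|k IH] F f g fg /=.
  move=> fC x Ux; have fgx : \near x, f x = g x.
    by have := open_nbhs_nbhs (conj oU Ux); exact: filterS.
  move: (fC x Ux); rewrite /prop_for /continuous_at -(fg x Ux) => fc.
  exact: cvg_trans (near_eq_cvg fgx) fc.
case=> df fC.
have dfg x : U x -> is_diff x g (frechet f x).
  move=> Ux; apply: (is_diff_near_eq (is_diff_blin (df x Ux))).
  by have := open_nbhs_nbhs (conj oU Ux); exact: filterS.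
split=> [x /dfg[]//|]; apply: (IH _ _ _ _ fC) => x Ux.
apply: blinP => y.
exact: (congr1 (@^~ y) (esym (is_diff_frechet (dfg x Ux)))).
Qed.

(** The induction step in all the closure properties below: it suffices to know
    a derivative on [U], whatever [frechet f] does elsewhere. *)
Lemma class_CS_is_diff k E F (U : set E) (f : E -> F) (df : E -> blin E F) :
  open U -> (forall x, U x -> is_diff x f (df x)) -> class_C k U df ->
  class_C k.+1 U f.
Proof.
move=> oU dfP dfC; split=> [x /dfP[]//|]; apply: (eq_class_C oU _ dfC) => x Ux.
by apply: blinP => y; rewrite (is_diff_frechet (dfP x Ux)).
Qed.

Lemma class_C_cst k E F (U : set E) (a : F) : open U -> class_C k U (fun=> a).
Proof.
move=> oU; elim: k F a => [|k IH] F a; first by move=> x _; exact: cst_continuous.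
by apply: (class_CS_is_diff oU _ (IH _ 0)) => x Ux; exact: is_diff_cst.
Qed.

Lemma class_C_blin k E F (U : set E) (L : blin E F) : open U -> class_C k U L.
Proof.
move=> oU; case: k => [|k]; first by move=> x _; exact: continuous_blin.
apply: (class_CS_is_diff oU _ (class_C_cst k L oU)) => x Ux.
split; first exact/linear_differentiable/continuous_blin.
exact/diff_lin/continuous_blin.
Qed.

Lemma class_CD k E F (U : set E) (f g : E -> F) :
  open U -> class_C k U f -> class_C k U g -> class_C k U (fun x => f x + g x).
Proof.
move=> oU; elim: k F f g => [|k IH] F f g /=.
  by move=> fc gc x Ux; apply: cvgD; [exact: fc|exact: gc].
case=> df fC [dg gC].
apply: (class_CS_is_diff oU _ (IH _ _ _ fC gC)) => x Ux.
exact: is_diffD (is_diff_blin (df x Ux)) (is_diff_blin (dg x Ux)).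
Qed.

(** Freezing [y] in [b (L h) y] gives an operator in [h] that depends bilinearly
    on [L] and [y]: the derivative of a product is a sum of two products of this
    kind, and the induction on [k] can be applied to them. *)
Lemma ex_bounded_bilinear_blinl D E F W (b : E -> F -> W) :
  bounded_bilinear b ->
  exists2 b1 : blin D E -> F -> blin D W,
    bounded_bilinear b1 & forall L y h, b1 L y h = b (L h) y.
Proof.
move=> bb; have [M M0 bM] := bounded_bilinear_ge0 bb; case: (bb) => bl br _.
have L1 (Ly : blin D E * F) :
    exists L' : blin D W, forall h, L' h = b (Ly.1 h) Ly.2.
  case: Ly => L y; have [||L' L'E] := @ex_blin R D W (fun h => b (L h) y).
  - by move=> a u v; rewrite linearP bl.
  - exists (M * opnorm L * `|y|) => h; rewrite (le_trans (bM _ _))//.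
    by rewrite [leRHS]mulrAC ler_wpM2r// -mulrA ler_wpM2l// opnormP.
  - by exists L' => h; rewrite L'E.
have [b1 b1E] := choice L1.
exists (fun L y => b1 (L, y)) => [|L y h]; last exact: b1E.
split=> [y a L L'|L a y y'|].
- by apply: blinP => h; rewrite blinDE !b1E/= bl.
- by apply/blinP => h; rewrite blinDE !b1E/= br.
- exists M => L y; apply: opnorm_le => [|h]; first by rewrite !mulr_ge0.
  rewrite b1E (le_trans (bM _ _))//= [leRHS]mulrAC.
  rewrite ler_wpM2r// -mulrA ler_wpM2l//.
  exact: opnormP.
Qed.

Lemma bounded_bilinear_sym E F W (b : E -> F -> W) :
  bounded_bilinear b -> bounded_bilinear (fun y x => b x y).
Proof.
by case=> bl br [M bM]; split=> //; exists M => y x; rewrite mulrAC.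
Qed.

(** By the product rule the derivative of [b f g] is again a sum of bounded
    bilinear products of C^k maps, with values in a space of operators; hence the
    induction quantifies over all the spaces but the source. *)
Lemma class_C_bilinear k E F1 F2 W (b : F1 -> F2 -> W) (U : set E)
    (f : E -> F1) (g : E -> F2) :
  open U -> bounded_bilinear b -> class_C k U f -> class_C k U g ->
  class_C k U (fun x => b (f x) (g x)).
Proof.
move=> oU; elim: k F1 F2 W b f g => [|k IH] F1 F2 W b f g bb.
  move=> fc gc x Ux.
  have [/differentiable_continuous bc _] := bounded_bilinear_diff (f x, g x) bb.
  apply: (@continuous_comp _ _ _ (fun x => (f x, g x))
    (fun q => b q.1 q.2)) => //.
  by apply: cvg_pair; [exact: fc|exact: gc].
move=> fC gC; have [df dfC] := fC; have [dg dgC] := gC.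
have [b1 bb1 b1E] := ex_bounded_bilinear_blinl E bb.
have [b2 bb2 b2E] := ex_bounded_bilinear_blinl E (bounded_bilinear_sym bb).
have dC := class_CD oU (IH _ _ _ _ _ _ bb2 dgC (class_CW fC))
                       (IH _ _ _ _ _ _ bb1 dfC (class_CW gC)).
apply: (class_CS_is_diff oU _ dC) => x Ux.
have := bounded_bilinear_comp_diff bb
  (is_diff_blin (df x Ux)) (is_diff_blin (dg x Ux)).
congr is_diff_def; apply/funext => h /=.
by rewrite -b2E -b1E.
Qed.

Lemma bounded_bilinear_comp D E F :
  exists2 c : blin E F -> blin D E -> blin D F,
    bounded_bilinear c & forall L M h, c L M h = L (M h).
Proof.
have ev : bounded_bilinear (fun (x : E) (L : blin E F) => L x).
  split=> [L|x a L M //|]; first exact: blin_linear.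
  by exists 1 => x L; rewrite mul1r mulrC; exact: opnormP.
have [c cb cE] := ex_bounded_bilinear_blinl D ev.
by exists (fun L M => c M L) => //; exact: bounded_bilinear_sym.
Qed.

(** The chain rule writes the derivative as the operator product of
    [frechet g \o f] and [frechet f], so the statement for [k] and the product
    lemma give the statement for [k.+1]. *)
Lemma class_C_comp k D E F (U : set D) (V : set E) (f : D -> E) (g : E -> F) :
  open U -> (forall x, U x -> V (f x)) ->
  class_C k U f -> class_C k V g -> class_C k U (fun x => g (f x)).
Proof.
move=> oU UV; elim: k F g => [|k IH] F g.
  move=> fc gc x Ux; apply: (@continuous_comp _ _ _ f g); first exact: fc.
  exact/gc/UV.
move=> fC [dg dgC]; have [df dfC] := fC.
have [c cb cE] := bounded_bilinear_comp D E F.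
have dC := class_C_bilinear oU cb (IH _ _ (class_CW fC) dgC) dfC.
apply: (class_CS_is_diff oU _ dC) => x Ux.
have := is_diff_comp (is_diff_blin (df x Ux))
  (is_diff_blin (dg _ (UV _ Ux))).
by congr is_diff_def; apply/funext => h /=; rewrite cE.
Qed.

Lemma class_C_blin_comp k E F W (U : set E) (L : blin F W) (f : E -> F) :
  open U -> class_C k U f -> class_C k U (fun x => L (f x)).
Proof.
move=> oU fC.
exact: (class_C_comp (V := setT) oU _ fC (class_C_blin k L openT)).
Qed.

Lemma bounded_bilinear_scale E : bounded_bilinear (fun (a : R^o) (x : E) => a *: x).
Proof.
split=> [x a u v|a b x y|]; first by rewrite scalerDl scalerA.
  by rewrite scalerDr !scalerA mulrC.
by exists 1 => a x; rewrite normrZ mul1r.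
Qed.

(** The function [1 / sqrt] is singled out because its derivative is a polynomial
    in itself, which makes the induction on [k] immediate; [sqrt r] and [r^-1] are
    recovered from it as [r * rsqrt r] and [rsqrt r * rsqrt r]. *)
Definition rsqrt (x : R) : R^o := (Num.sqrt x)^-1.

Lemma is_diff_rsqrt (x : R) : 0 < x ->
  is_diff x rsqrt (fun h => - 2^-1 * rsqrt x ^+ 3 * h).
Proof.
move=> x0; have s0 : Num.sqrt x != 0 by rewrite gt_eqF// sqrtr_gt0.
have [ds Ds] := is_derive1_sqrt x0.
have dr : derivable rsqrt x 1 by exact: (derivableV s0 ds).
split; first exact/derivable1_diffP.
rewrite deriv1E// derive1E (deriveV s0 ds) Ds.
apply/funext => h; rewrite /rsqrt.
rewrite [in LHS]/GRing.scale/=.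
by field.
Qed.

Lemma bounded_bilinear_mul : bounded_bilinear (fun a b : R^o => a * b : R^o).
Proof. exact: (bounded_bilinear_scale R^o). Qed.

Lemma class_CM k E (U : set E) (f g : E -> R^o) : open U ->
  class_C k U f -> class_C k U g -> class_C k U (fun x => f x * g x : R^o).
Proof. by move=> oU; exact: class_C_bilinear oU bounded_bilinear_mul. Qed.

Lemma class_C_scale k E F (U : set E) (f : E -> R^o) (g : E -> F) : open U ->
  class_C k U f -> class_C k U g -> class_C k U (fun x => f x *: g x).
Proof. by move=> oU; exact: class_C_bilinear oU (bounded_bilinear_scale F). Qed.

Lemma class_C_rsqrt k : class_C k [set x : R | 0 < x] rsqrt.
Proof.
have oU : open [set x : R | 0 < x] by exact: open_gt.
have [I IE] := ex_id_blin R.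
elim: k => [|k IH].
  move=> x x0; have [/differentiable_continuous] := is_diff_rsqrt x0; exact.
have dC : class_C k [set x : R | 0 < x]
    (fun x => (- 2^-1 * (rsqrt x * (rsqrt x * rsqrt x)) : R^o) *: I).
  by apply: class_C_scale => //; do ?apply: class_CM => //; exact: class_C_cst.
apply: (class_CS_is_diff oU _ dC) => x x0; have := is_diff_rsqrt x0.
congr is_diff_def; apply/funext => h.
by rewrite -(expr2 (rsqrt x)) -exprS -[RHS]/(_ * I h) IE.
Qed.
End ClassC.

Section SmoothnessMin.
Context (R : realType).

(** The classes are nested, so of the two sets of exponents for [g] and [h] one
    contains the other, and their intersection is the smaller one. *)
Lemma smoothness_min (E1 E2 E3 F1 F2 F3 : normedModType R)
    (U : set E1) (V : set E2) (W : set E3)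
    (f : E1 -> F1) (g : E2 -> F2) (h : E3 -> F3) :
  (forall k, class_C k U f <-> class_C k V g /\ class_C k W h) ->
  smoothness U f = mine (smoothness V g) (smoothness W h).
Proof.
move=> fgh.
have sub (A B : set nat) : A `<=` B ->
    (ereal_sup [set (k%:R%:E : \bar R) | k in A] <=
     ereal_sup [set k%:R%:E | k in B])%E.
  move=> AB; apply: ereal_sup_le => _ [k Ak <-].
  by exists k => //; exact: AB.
have [gh|/existsNP[k /not_implyP[gk hk]]] :=
    pselect (forall k, class_C k V g -> class_C k W h).
  have -> : smoothness U f = smoothness V g.
    rewrite /smoothness; congr (ereal_sup (image _ _)).
    apply/seteqP; split=> k /=; rewrite fgh; first by case.
    by move=> gk; split=> //; exact: gh.
  by apply/esym/min_idPl; exact: sub.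
have hg l : class_C l W h -> class_C l V g.
  move=> hl; have [lk|kl] := leqP l k; first exact: class_C_le gk.
  by case: hk; exact: class_C_le (ltnW kl) hl.
have -> : smoothness U f = smoothness W h.
  rewrite /smoothness; congr (ereal_sup (image _ _)).
  apply/seteqP; split=> l /=; rewrite fgh; first by case.
  by move=> hl; split=> //; exact: hg.
by apply/esym/min_idPr; exact: sub.
Qed.

End SmoothnessMin.

(** * Isometries of an inner product space *)

Section Scalars.
Context (R : realType) (c : scalar_kind).
Local Notation K := (scalar_field R c).
Implicit Types z : K.

Lemma sconj_fixed z : sconj z = z -> z = of_real c (sRe z).
Proof.
case: c z => //= -[x y] [] /eqP; rewrite eq_sym -addr_eq0 -mulr2n mulrn_eq0 /=.
by move=> /eqP ->.
Qed.

Lemma of_realK : cancel (of_real c) (@sRe R c).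
Proof. by case: c. Qed.

Lemma of_real_gt0 (a : R) : (0 < of_real c a) = (0 < a).
Proof. by case: c => //=; rewrite ltcE /= eqxx. Qed.

Lemma of_real_ge0 (a : R) : (0 <= of_real c a) = (0 <= a).
Proof. by case: c => //=; rewrite lecE /= eqxx. Qed.

End Scalars.

Lemma addfV (F : fieldType) (p q : F) : p != 0 -> q != 0 ->
  p^-1 + q^-1 = p^-1 * q^-1 * (p + q).
Proof. by move=> p0 q0; field; rewrite p0 q0. Qed.

Lemma split_form_eq (F : fieldType) (a b s g p q : F) : g != 0 ->
  a * (b * s) + p * q =
  p * (a * (b * g) + q) + (s / g - p) / g * (a * g) * (b * g).
Proof. by move=> g0; field. Qed.

Section InnerProduct.
Context (R : realType) (c : scalar_kind).
Local Notation K := (scalar_field R c).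
Context (H : lmodType K) (ip : {dot H for @sconj R c}).
Implicit Types (x y f g h e w : H) (a : K).

Lemma ip0r x : ip x 0 = 0. Proof. by rewrite ipC ip0 rmorph0. Qed.
Lemma ipN x y : ip (- x) y = - ip x y.
Proof. by rewrite -scaleN1r ipZ mulN1r. Qed.
Lemma ipNr x y : ip x (- y) = - ip x y.
Proof. by rewrite ipC ipN rmorphN /= -ipC. Qed.
Lemma ip_orthC x y : ip x y = 0 -> ip y x = 0.
Proof. by rewrite ipC => /(congr1 sconj); rewrite sconjK rmorph0. Qed.

Lemma ip_eq0 x : (ip x x == 0) = (x == 0).
Proof.
by have [->|/(@ip_gt0 _ _ _ ip)/gt_eqF->//] := eqVneq x 0; rewrite ip0 eqxx.
Qed.

Lemma ip_real x : ip x x = of_real c (`|x : ip_space ip| ^+ 2).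
Proof. by rewrite ip_norm_sqr; apply: sconj_fixed; rewrite -ipC. Qed.

Lemma orth_decomp f g : exists a f0,
  [/\ f = a *: g + f0, ip f0 g = 0 & ip g f0 = 0].
Proof.
exists (ip f g / ip g g), (f - (ip f g / ip g g) *: g).
suff fg : ip (f - (ip f g / ip g g) *: g) g = 0.
  by split; [rewrite addrC subrK|exact: fg|exact: ip_orthC].
have [->|g0] := eqVneq g 0; first by rewrite ip0r.
by rewrite ipD ipN ipZ divfK ?subrr// ip_eq0.
Qed.

(** A complex version of the Householder reflection: multiplication by a
    unimodular number on the line of [w], the identity on its orthogonal. *)
Lemma ex_rank_one_isometry w a :
  a + sconj a = a * sconj a * ip w w ->
  exists2 T : {linear H -> H}, isometry ip ip T &
    forall x, T x = x - (a * ip x w) *: w.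
Proof.
move=> aw; pose t x := x - (a * ip x w) *: w.
have tl : linear t.
  move=> b x y; rewrite /t ipD ipZ mulrDr mulrCA scalerDl opprD scalerBr.
  by rewrite scalerA addrACA.
pose tM := GRing.isLinear.Build _ _ _ _ t tl.
pose T : {linear H -> H} := HB.pack t tM.
exists T => // x y; rewrite /= /t !(ipD, ipDr, ipN, ipNr, ipZ, ipZr) rmorphM /=.
rewrite (ipC ip w y).
set p := ip x w; set q := sconj (ip y w); set n := ip w w in aw *.
rewrite -[RHS]addr0 -!addrA; congr (_ + _).
have -> : 0 = - (p * q) * (a + sconj a - a * sconj a * n).
  by rewrite aw subrr mulr0.
by ring.
Qed.

(** Vectors of equal norm are exchanged by an isometry of [H]. Since it moves
    only the line of [g - g'], it fixes everything orthogonal to both, and this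
    is the source of isometries in the stabilizer of a vector. *)
Lemma ex_isometry_mapping g g' : ip g g = ip g' g' ->
  exists T : {linear H -> H}, [/\ isometry ip ip T, T g = g' &
    forall x, ip x g = 0 -> ip x g' = 0 -> T x = x].
Proof.
move=> gg'; have [<-|ng] := eqVneq g g'.
  by exists idfun; split=> // x y.
pose w := g - g'; pose p := ip g w.
have ww : ip w w = p + sconj p.
  rewrite /p -ipC /w !(ipD, ipDr, ipN, ipNr) gg'; ring.
have w0 : w != 0 by rewrite subr_eq0.
have p0 : p != 0.
  apply: contraNneq w0 => p0; rewrite -ip_eq0 ww p0 rmorph0 addr0//.
have pc0 : sconj p != 0 by rewrite fmorph_eq0.
(* The coefficient is forced by T g = g - w. *)
have [|T Tiso TE] := @ex_rank_one_isometry w p^-1.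
  by rewrite fmorphV ww; exact: addfV.
exists T; split=> // [|x xg xg'].
  by rewrite TE mulVf// scale1r opprB addrC subrK.
by rewrite TE /w ipDr ipNr xg xg' subr0 mulr0 scale0r subr0.
Qed.

Lemma one_dimensional_or_orth g : g != 0 ->
  one_dimensional H \/ exists2 e, e != 0 & ip e g = 0.
Proof.
move=> g0.
have [[e [e0 eg]]|no_orth] := pselect (exists e, e != 0 /\ ip e g = 0).
  by right; exists e.
left; exists g => // x; have [a [x0 [xE x0g _]]] := orth_decomp x g.
exists a; rewrite xE; have [->|nx0] := eqVneq x0 0; first by rewrite addr0.
by exfalso; apply: no_orth; exists x0.
Qed.

End InnerProduct.

(** * Forms invariant under the stabilizer of a vector *)

Section Forms.
Context (R : realType) (c : scalar_kind).
Local Notation K := (scalar_field R c).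
Context (H : lmodType K) (ip : {dot H for @sconj R c}).
Implicit Types (s : H -> H -> K) (x y f g h e w : H) (a : K).

Lemma sesqD s x y z : conj_symmetric_sesquilinear s ->
  s (x + y) z = s x z + s y z.
Proof. by case=> s' ->; exact: linearDl. Qed.
Lemma sesqDr s x y z : conj_symmetric_sesquilinear s ->
  s z (x + y) = s z x + s z y.
Proof. by case=> s' ->; exact: linearDr. Qed.
Lemma sesqZ s a x z : conj_symmetric_sesquilinear s ->
  s (a *: x) z = a * s x z.
Proof. by case=> s' ->; exact: linearZl_LR. Qed.
Lemma sesqZr s a x z : conj_symmetric_sesquilinear s ->
  s z (a *: x) = sconj a * s z x.
Proof. by case=> s' ->; exact: linearZr_LR. Qed.
Lemma sesqC s x y : conj_symmetric_sesquilinear s -> s x y = sconj (s y x).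
Proof. by case=> s' ->; rewrite [LHS]hermC expr0 mul1r. Qed.

Lemma sesq_real s x : conj_symmetric_sesquilinear s ->
  s x x = of_real c (sRe (s x x)).
Proof. by move=> hs; apply: sconj_fixed; rewrite -sesqC. Qed.

Section Stabilizer.
Context (s : H -> H -> K) (g : H).
Context (hs : conj_symmetric_sesquilinear s).
Context (stab : forall T : {linear H -> H}, isometry ip ip T -> T g = g ->
  forall f h, s (T f) (T h) = s f h).

(** The reflection [f |-> - f] fixes [g] and [x], so [s x f = - s x f]. With
    [x := g] this separates the line of [g] from its orthogonal. *)
Lemma stabilizer_orth x f : ip f g = 0 -> ip x f = 0 -> s x f = 0.
Proof.
move=> fg xf.
have [|T [Tiso Tf Tx]] := @ex_isometry_mapping _ _ _ ip f (- f).
  by rewrite ipN ipNr opprK.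
have Tfix z : ip z f = 0 -> T z = z by move=> zf; rewrite Tx// ipNr zf oppr0.
have := stab Tiso (Tfix _ (ip_orthC fg)) x f.
rewrite (Tfix _ xf) Tf -scaleN1r sesqZr// rmorphN1 mulN1r => /eqP.
by rewrite eq_sym -addr_eq0 -mulr2n mulrn_eq0 => /eqP.
Qed.

Lemma stabilizer_isotropic e f : ip e g = 0 -> ip f g = 0 ->
  ip e e = ip f f -> s e e = s f f.
Proof.
move=> eg fg ef; have [T [Tiso Te Tx]] := ex_isometry_mapping ef.
by rewrite -(stab Tiso (Tx _ (ip_orthC eg) (ip_orthC fg))) Te.
Qed.

(** On the orthogonal of [g], [s f f] is a multiple of the squared norm: rescale
    [e] to the norm of [f] and compare by an isometry. *)
Lemma stabilizer_proportional e f : e != 0 -> ip e g = 0 -> ip f g = 0 ->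
  s f f * ip e e = s e e * ip f f.
Proof.
move=> e0 eg fg.
pose t : K := of_real c (`|f : ip_space ip| / `|e : ip_space ip|).
have ff : ip f f = t * t * ip e e.
  rewrite !ip_real /t -!rmorphM; congr of_real.
  by field; rewrite (normr_eq0 (e : ip_space ip)).
have <- : s (t *: e) (t *: e) = s f f.
  apply: stabilizer_isotropic; rewrite ?ipZ ?eg ?mulr0//.
  by rewrite ipZr sconj_real mulrA -ff.
by rewrite sesqZ// sesqZr// sconj_real ff; ring.
Qed.

(** Up to scalars, [s] is the inner product on the orthogonal of [g], by
    proportionality on the diagonal and orthogonality off it; it is diagonal for
    the decomposition along [g], where its value [s g g] is free. The coefficient
    [psi] corrects [phi] on the line of [g]. *)
Lemma stabilizer_form e : g != 0 -> e != 0 -> ip e g = 0 ->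
  exists phi psi : R, forall f h,
    s f h = of_real c phi * ip f h + of_real c psi * ip f g * ip g h.
Proof.
move=> g0 e0 eg.
pose phi := sRe (s e e) / `|e : ip_space ip| ^+ 2.
pose psi :=
  (sRe (s g g) / `|g : ip_space ip| ^+ 2 - phi) / `|g : ip_space ip| ^+ 2.
exists phi, psi => f h.
have gg : ip g g != 0 by rewrite ip_eq0.
have ee : ip e e != 0 by rewrite ip_eq0.
have phiE : of_real c phi = s e e / ip e e.
  by rewrite (sesq_real e hs) ip_real rmorphM fmorphV.
have psiE : of_real c psi = (s g g / ip g g - of_real c phi) / ip g g.
  by rewrite (sesq_real g hs) (ip_real ip g) !(rmorphM, rmorphB, fmorphV).
have [a [f0 [fE f0g gf0]]] := orth_decomp ip f g.
have [b [h0 [hE h0g gh0]]] := orth_decomp ip h g.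
have sfh : s f0 h0 = of_real c phi * ip f0 h0.
  have [d [h1 [h0E h1f f0h1]]] := orth_decomp ip h0 f0.
  have h1g : ip h1 g = 0.
    by move: h0g; rewrite h0E ipD ipZ f0g mulr0 add0r.
  rewrite h0E sesqDr// sesqZr// (stabilizer_orth h1g f0h1) addr0.
  rewrite ipDr ipZr f0h1 addr0 mulrCA; congr (_ * _); apply: (mulIf ee).
  by rewrite stabilizer_proportional// phiE mulrAC divfK.
have sgh : s g h0 = 0 by rewrite stabilizer_orth.
have sfg : s f0 g = 0 by rewrite sesqC// stabilizer_orth ?rmorph0.
have -> : s f h = a * (sconj b * s g g) + of_real c phi * ip f0 h0.
  rewrite fE hE sesqD// !sesqDr// !sesqZ// !sesqZr// sgh sfg sfh.
  by rewrite !mulr0 addr0 add0r.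
have -> : ip f h = a * (sconj b * ip g g) + ip f0 h0.
  by rewrite fE hE ipD !ipDr !ipZ !ipZr f0g gh0 !mulr0 addr0 add0r.
have -> : ip f g = a * ip g g by rewrite fE ipD ipZ f0g addr0.
have -> : ip g h = sconj b * ip g g by rewrite hE ipDr ipZr gh0 addr0.
by rewrite psiE; exact: split_form_eq.
Qed.
End Stabilizer.

Lemma sesq_one_dimensional s g : conj_symmetric_sesquilinear s ->
  g != 0 -> one_dimensional H -> forall f h,
  s f h = of_real c (sRe (s g g) / `|g : ip_space ip| ^+ 2) * ip f h.
Proof.
move=> hs g0 [e e0 gen] f h.
have gg : ip g g != 0 by rewrite ip_eq0.
have {e e0}gen x : exists a, x = a *: g.
  have [[a xa] [b gb]] := (gen x, gen g).
  have b0 : b != 0 by apply: contraNneq g0 => b0; rewrite gb b0 scale0r.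
  by exists (a / b); rewrite gb scalerA divfK.
have [[a ->] [b ->]] := (gen f, gen h).
rewrite sesqZ// sesqZr// ipZ ipZr rmorphM fmorphV /= -(ip_real ip g).
by rewrite -(sesq_real g hs) [RHS]mulrCA [in RHS](mulrCA (_ / _)) divfK.
Qed.

End Forms.

(** * Representation and positivity *)

Section Representation.
Context (R : realType) (c : scalar_kind).
Local Notation K := (scalar_field R c).
Context (H : lmodType K) (ip : {dot H for @sconj R c}).
Local Notation X := (ip_space ip).
Context (G : set X) (sigma : H -> H -> H -> K).
Context (Ginv : isometry_invariant_set G) (G0 : ~ G 0).
Context (sigma_sesq :
  forall g : H, G g -> conj_symmetric_sesquilinear (sigma g)).

Lemma G_neq0 g : G g -> g != 0.
Proof. by move=> Gg; apply/eqP => g0; apply: G0; rewrite -g0. Qed.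

Lemma ex_isometry_same_norm (g g' : X) : `|g| = `|g'| ->
  exists2 T : {linear H -> H}, isometry ip ip T & T g = g'.
Proof.
move=> gg'; have [|T [Tiso Tg _]] := @ex_isometry_mapping _ _ _ ip g g'.
  by rewrite !ip_real gg'.
by exists T.
Qed.

(** By transitivity on spheres, [G] is a union of spheres. *)
Lemma sqr_normsP (g : X) : sqr_norms G (`|g| ^+ 2) <-> G g.
Proof.
split=> [[g' Gg' /eqP]|Gg]; last by exists g.
rewrite eqrXn2// => /eqP/ex_isometry_same_norm[T Tiso <-].
by apply: (Ginv Tiso); exists g'.
Qed.

Lemma sqr_norms_gt0 r : sqr_norms G r -> 0 < r.
Proof. by case=> g Gg <-; rewrite exprn_gt0// normr_gt0 G_neq0. Qed.

Lemma isometry_norm (T : {linear H -> H}) (g : X) :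
  isometry ip ip T -> `|T g : X| = `|g|.
Proof.
move=> Tiso; apply/eqP; rewrite -(eqrXn2 (n := 2))//; apply/eqP.
by rewrite !ip_norm_sqr Tiso.
Qed.

Lemma represents_invariant phi psi :
  represents G sigma phi psi -> isometry_invariant G sigma.
Proof.
move=> rep T Tiso g f h Gg.
have GTg : G (T g) by apply: (Ginv Tiso); exists g.
by rewrite !rep// isometry_norm// !Tiso.
Qed.

(** Choose one [g] on each sphere, apply the stabilizer lemma there, and transport
    to the whole sphere by isometries. If [H] is a line, the two terms of the
    formula are proportional and only [phi + r psi] is determined; taking
    [psi = 0] makes positivity and smoothness of [sigma] those of [phi]. *)
Lemma invariant_represents : isometry_invariant G sigma ->
  exists phi psi : R -> R, represents G sigma phi psi /\
    (one_dimensional H -> forall r, sqr_norms G r -> psi r = 0).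
Proof.
move=> inv.
have pointwise r : exists ab : R * R, sqr_norms G r ->
    (exists2 g : X, G g /\ `|g| ^+ 2 = r & forall f h, sigma g f h =
       of_real c ab.1 * ip f h + of_real c ab.2 * ip f g * ip g h) /\
    (one_dimensional H -> ab.2 = 0).
  have [[g Gg gr]|nr] := pselect (sqr_norms G r); last by exists 0.
  have g0 := G_neq0 Gg; have hs := sigma_sesq Gg.
  have stab (T : {linear H -> H}) : isometry ip ip T -> T g = g ->
      forall f h, sigma g (T f) (T h) = sigma g f h.
    by move=> Tiso Tg f h; rewrite -[RHS](inv T)// Tg.
  have [dim1|dim2] := pselect (one_dimensional H).
    exists (sRe (sigma g g g) / `|g| ^+ 2, 0) => _; split=> //.
    exists g => // f h; rewrite rmorph0 !mul0r addr0.
    exact: sesq_one_dimensional.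
  have [//|[e e0 eg]] := one_dimensional_or_orth ip g0.
  have [a [b sE]] := stabilizer_form hs stab g0 e0 eg.
  by exists (a, b) => _; split=> //; exists g.
have [ab abP] := choice pointwise.
exists (fun r => (ab r).1), (fun r => (ab r).2); split; last first.
  by move=> dim1 r /abP[_]; exact.
move=> g f h Gg; have [[g' [Gg' g'g] sE] _] := abP _ ((sqr_normsP g).2 Gg).
have [|T Tiso Tg] := @ex_isometry_same_norm g g'.
  by apply/eqP; rewrite -(eqrXn2 (n := 2))// g'g.
by rewrite -(inv T)// Tg sE -Tg !Tiso.
Qed.

Lemma represents_diag phi psi (g : X) : represents G sigma phi psi -> G g ->
  sigma g g g =
  of_real c (phi (`|g| ^+ 2) + `|g| ^+ 2 * psi (`|g| ^+ 2)) * ip g g.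
Proof. by move=> rep Gg; rewrite rep// ip_real !(rmorphD, rmorphM); ring. Qed.

Lemma represents_orth phi psi (g : X) e : represents G sigma phi psi -> G g ->
  ip e g = 0 -> sigma g e e = of_real c (phi (`|g| ^+ 2)) * ip e e.
Proof. by move=> rep Gg eg; rewrite rep// eg mulr0 mul0r addr0. Qed.

Lemma represents_unique phi psi phi' psi' : ~ one_dimensional H ->
  represents G sigma phi psi -> represents G sigma phi' psi' ->
  forall r, sqr_norms G r -> phi' r = phi r /\ psi' r = psi r.
Proof.
move=> dim2 rep rep' _ [g Gg <-]; have g0 := G_neq0 Gg.
have [//|[e e0 eg]] := one_dimensional_or_orth ip g0.
have phiE : phi' (`|g| ^+ 2) = phi (`|g| ^+ 2).
  apply: (can_inj (@of_realK R c)).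
  apply: (@mulIf _ (ip e e)); first by rewrite ip_eq0.
  by rewrite -(represents_orth rep Gg eg) -(represents_orth rep' Gg eg).
split=> //; have : phi' (`|g| ^+ 2) + `|g| ^+ 2 * psi' (`|g| ^+ 2)
           = phi (`|g| ^+ 2) + `|g| ^+ 2 * psi (`|g| ^+ 2).
  apply: (can_inj (@of_realK R c)).
  apply: (@mulIf _ (ip g g)); first by rewrite ip_eq0.
  by rewrite -(represents_diag rep Gg) -(represents_diag rep' Gg).
by rewrite phiE => /addrI/mulfI; apply; rewrite expf_neq0// normr_eq0.
Qed.

(** Splitting [f] along [g] diagonalizes [sigma g], with coefficient
    [phi + r psi] on the line of [g] and [phi] on its orthogonal. On a line the
    orthogonal is trivial and [psi = 0] makes both coefficients equal. *)
Lemma positive_definiteP phi psi (g : X) : represents G sigma phi psi ->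
  (one_dimensional H -> forall r, sqr_norms G r -> psi r = 0) -> G g ->
  positive_definite (sigma g) <->
  0 < phi (`|g| ^+ 2) /\ 0 < phi (`|g| ^+ 2) + `|g| ^+ 2 * psi (`|g| ^+ 2).
Proof.
move=> rep psi0 Gg; have g0 := G_neq0 Gg.
have gg := ip_gt0 ip g0.
split=> [pos|[phi_gt0 psi_gt0] f f0].
  have pg : 0 < phi (`|g| ^+ 2) + `|g| ^+ 2 * psi (`|g| ^+ 2).
    have := pos g g0; rewrite (represents_diag rep Gg).
    by rewrite pmulr_lgt0// of_real_gt0.
  split=> //; have [dim1|[e e0 eg]] := one_dimensional_or_orth ip g0.
    by move: pg; rewrite psi0 ?mulr0 ?addr0//; apply/sqr_normsP.
  have := pos e e0; rewrite (represents_orth rep Gg eg).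
  by rewrite pmulr_lgt0 ?ip_gt0// of_real_gt0.
have [a [f1 [fE f1g gf1]]] := orth_decomp ip f g.
have -> : sigma g f f = of_real c (phi (`|g| ^+ 2)) * ip f1 f1
   + of_real c (phi (`|g| ^+ 2) + `|g| ^+ 2 * psi (`|g| ^+ 2))
     * (a * sconj a * ip g g).
  have -> : sigma g f f = sigma g f1 f1 + a * sconj a * sigma g g g.
    have hs := sigma_sesq Gg.
    rewrite fE (sesqD _ _ _ hs) !(sesqDr _ _ _ hs) !(sesqZ _ _ _ hs).
    rewrite !(sesqZr _ _ _ hs) (rep g g f1)// (rep g f1 g)// f1g gf1.
    by rewrite !(mulr0, mul0r, addr0, add0r) addrC mulrA.
  by rewrite (represents_diag rep Gg) (represents_orth rep Gg f1g) mulrCA.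
have [f10|f10] := eqVneq f1 0.
  rewrite f10 ip0 mulr0 add0r mulr_gt0 ?of_real_gt0// mulr_gt0// mul_sconj_gt0//.
  by apply: contraNneq f0 => a0; rewrite fE f10 a0 scale0r addr0.
apply: ltr_pwDl; first by rewrite mulr_gt0 ?of_real_gt0// ip_gt0.
apply: mulr_ge0; first by rewrite of_real_ge0 ltW.
apply: mulr_ge0; last exact: ltW.
by have [->|/mul_sconj_gt0/ltW//] := eqVneq a 0; rewrite mul0r.
Qed.

Lemma represents_positivity phi psi : represents G sigma phi psi ->
  (one_dimensional H -> forall r, sqr_norms G r -> psi r = 0) ->
  positivity_criterion G sigma phi psi.
Proof.
move=> rep psi0 r Gr; have r0 := sqr_norms_gt0 Gr.
have sphereE (g : X) : sphere (Num.sqrt r) g -> G g /\ `|g| ^+ 2 = r.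
  move=> gr; have {}gr : `|g| ^+ 2 = r by rewrite gr sqr_sqrtr// ltW.
  by split=> //; apply/sqr_normsP; rewrite gr.
have posE (g : X) : sphere (Num.sqrt r) g ->
    positive_definite (sigma g) <-> 0 < phi r /\ 0 < phi r + r * psi r.
  by move=> Sg; have [Gg <-] := sphereE _ Sg; exact: positive_definiteP.
have [g _ gr] := Gr.
have Sg : sphere (ip := ip) (Num.sqrt r) g.
  by rewrite /sphere /= -gr sqrtr_sqr normr_id.
split; split.
- by move=> [g' Sg' /(posE g' Sg')].
- by move=> /(posE g Sg); exists g.
- by move=> /(_ g Sg)/(posE g Sg).
- by move=> pos g' Sg'; apply/(posE g' Sg').
Qed.

End Representation.

(** * Bounded real bilinear maps on an inner product space *)

(** The norm in the form in which [bounded_bilinear] speaks of it, by way of the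
    normed module; the scalar field and [ip_space] also reach their norms through
    their own instances. *)
Definition norm_of (R : realType) (E : normedModType R) (x : E) : R := `|x|.

Section RealBilinear.
Context (R : realType) (c : scalar_kind).
Local Notation K := (scalar_field R c).
Local Notation Ks := (scalar_space R c).

Lemma norm_of_ge0 (E : normedModType R) (x : E) : 0 <= norm_of x.
Proof. exact: normr_ge0. Qed.

Lemma eq_norm_of (E : normedModType R) (x : E) (M : R) : 0 <= M ->
  of_real c (norm_of x ^+ 2) = of_real c (M ^+ 2) -> norm_of x = M.
Proof.
move=> M0 /(can_inj (@of_realK R c))/eqP; rewrite eqrXn2 ?norm_of_ge0//.
by move/eqP.
Qed.

Lemma mul_sconj_norm (z : Ks) :
  (z : K) * sconj (z : K) = of_real c (norm_of z ^+ 2).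
Proof.
have zE : norm_of z ^+ 2 = sRe ((z : K) * sconj (z : K)).
  exact: (@ip_norm_sqr R c K^o (@scalar_ip R c) z).
by rewrite zE; apply: sconj_fixed; rewrite [LHS]rmorphM /= sconjK mulrC.
Qed.

Lemma norm_ofM (z w : Ks) :
  norm_of ((z : K) * (w : K) : Ks) = norm_of z * norm_of w.
Proof.
apply: eq_norm_of; first by rewrite mulr_ge0 ?norm_of_ge0.
rewrite -mul_sconj_norm exprMn.
have -> : of_real c (norm_of z ^+ 2 * norm_of w ^+ 2) =
          ((z : K) * sconj (z : K)) * ((w : K) * sconj (w : K)).
  by rewrite rmorphM !mul_sconj_norm.
have -> : sconj ((z : K) * (w : K)) = sconj (z : K) * sconj (w : K).
  by rewrite rmorphM.
exact: mulrACA.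
Qed.

Lemma ex_sRe_blin : exists L : blin Ks R^o, L = @sRe R c :> (Ks -> R^o).
Proof.
apply: ex_blin => [a z w|].
  by rewrite raddfD; congr (_ + _); exact: sReZ.
exists 1 => z; rewrite mul1r -/(norm_of z).
suff : `|sRe (z : K) : R| ^+ 2 <= norm_of z ^+ 2.
  by rewrite ler_pXn2r ?nnegrE ?norm_of_ge0.
have -> : norm_of z ^+ 2 = sRe ((z : K) * sconj (z : K)).
  by rewrite mul_sconj_norm of_realK.
rewrite real_normK ?num_real//.
case: c z => /= [z|[x y]]; first by rewrite expr2.
by rewrite -sqr_normc -add_Re2_Im2 /= lerDl sqr_ge0.
Qed.

Lemma bounded_bilinear_scalar_mul :
  bounded_bilinear (fun z w : Ks => (z : K) * (w : K) : Ks).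
Proof.
split=> [w a z z'|z a w w'|]; rewrite ?mulrDl ?mulrDr.
- by congr (_ + _); exact: esym (mulrA (of_real c a) (z : K) (w : K)).
- by congr (_ + _); exact: (mulrCA (z : K) (of_real c a) (w : K)).
exists 1 => z w; rewrite mul1r -!/(norm_of _) norm_ofM; exact: lexx.
Qed.

Context (H : lmodType K) (ip : {dot H for @sconj R c}).
Local Notation X := (ip_space ip).

Lemma ip_norm_of (x : X) : ip x x = of_real c (norm_of x ^+ 2).
Proof. exact: ip_real. Qed.

(** The bound is the Cauchy-Schwarz inequality for the scalar-valued inner
    product, read off the norm of the component of [x] orthogonal to [y]. *)
Lemma bounded_bilinear_ip : bounded_bilinear (fun x y : X => ip x y : Ks).
Proof.
split=> [y a x x'|x a y y'|].
- by rewrite ipD; congr (_ + _); exact: ipZ.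
- by rewrite ipDr; congr (_ + _); rewrite [LHS]ipZr sconj_real.
exists 1 => x y; rewrite mul1r -!/(norm_of _).
suff : norm_of (ip x y : Ks) ^+ 2 <= (norm_of x * norm_of y) ^+ 2.
  by rewrite ler_pXn2r ?nnegrE ?mulr_ge0 ?norm_of_ge0.
have [a [x0 [xE x0y yx0]]] := orth_decomp ip x y.
suff -> : (norm_of x * norm_of y) ^+ 2 =
    norm_of (ip x y : Ks) ^+ 2 + (norm_of (x0 : X) * norm_of y) ^+ 2.
  by rewrite lerDl sqr_ge0.
apply: (can_inj (@of_realK R c)); rewrite !exprMn.
rewrite rmorphM rmorphD [X in _ + X]rmorphM /=.
rewrite -mul_sconj_norm -!ip_norm_of xE !(ipD, ipDr, ipZ, ipZr) x0y yx0.
rewrite !(mulr0, addr0, add0r) rmorphM /= -(ipC ip y y) mulrDl; congr (_ + _).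
by move: (sconj a) (ip y y) => b n; rewrite mulrACA !mulrA.
Qed.

End RealBilinear.

(** * Smoothness *)

Section SmoothnessOfForm.
Context (R : realType) (c : scalar_kind).
Local Notation K := (scalar_field R c).
Local Notation Ks := (scalar_space R c).
Context (H : lmodType K) (ip : {dot H for @sconj R c}).
Local Notation X := (ip_space ip).
Context (G : set X) (sigma : H -> H -> H -> K).
Context (Ginv : isometry_invariant_set G) (Gopen : open G) (G0 : ~ G 0).

Let U : set (X * X * X) := [set p | G p.1.1].
Let S (p : X * X * X) : Ks := sigma p.1.1 p.1.2 p.2.

Lemma ex_proj_blin : exists L1 L2 L3 : blin (X * X * X)%type X,
  [/\ forall p, L1 p = p.1.1, forall p, L2 p = p.1.2 & forall p, L3 p = p.2].
Proof.
have lefst (E F : normedModType R) (p : E * F) : `|p.1| <= `|p|.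
  by rewrite prod_normE le_max lexx.
have lesnd (E F : normedModType R) (p : E * F) : `|p.2| <= `|p|.
  by rewrite prod_normE le_max lexx orbT.
have [//||L1 L1E] := @ex_blin R (X * X * X)%type X (fun p => p.1.1).
  by exists 1 => p; rewrite mul1r; exact: le_trans (lefst _ _ p.1) (lefst _ _ p).
have [//||L2 L2E] := @ex_blin R (X * X * X)%type X (fun p => p.1.2).
  by exists 1 => p; rewrite mul1r; exact: le_trans (lesnd _ _ p.1) (lefst _ _ p).
have [//||L3 L3E] := @ex_blin R (X * X * X)%type X (fun p => p.2).
  by exists 1 => p; rewrite mul1r; exact: lesnd.
by exists L1, L2, L3; split=> p; rewrite ?L1E ?L2E ?L3E.
Qed.

Lemma open_U : open U.
Proof.
have [L1 [_ [_ [L1E _ _]]]] := ex_proj_blin.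
have -> : U = L1 @^-1` G by apply/seteqP; split=> p; rewrite /U /= L1E.
by apply: open_comp => // p _; exact: continuous_blin.
Qed.

(** The formula builds [sigma] from [phi] and [psi], composed with the squared
    norm, by sums and bounded bilinear products, all of which preserve C^k. *)
Lemma class_C_represents k phi psi : represents G sigma phi psi ->
  class_C k (sqr_norms G) (phi : R -> R^o) ->
  class_C k (sqr_norms G) (psi : R -> R^o) -> class_C k U S.
Proof.
move=> rep phiC psiC; have oU := open_U.
have [L1 [L2 [L3 [L1E L2E L3E]]]] := ex_proj_blin.
have [Re ReE] := ex_sRe_blin R c.
have bip := bounded_bilinear_ip ip.
have ipC (L M : blin (X * X * X)%type X) :
    class_C k U (fun p => ip (L p) (M p) : Ks).
  exact: (class_C_bilinear oU bip (class_C_blin k L oU) (class_C_blin k M oU)).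
have NC : class_C k U (fun p => Re (ip (L1 p) (L1 p))).
  exact: class_C_blin_comp oU (ipC L1 L1).
have NE p : Re (ip (L1 p) (L1 p)) = `|p.1.1| ^+ 2.
  by rewrite ReE L1E ip_norm_sqr.
have N_R2 p : U p -> sqr_norms G (Re (ip (L1 p) (L1 p))).
  by move=> Up; rewrite NE; exists p.1.1.
have phiNC := class_C_comp oU N_R2 NC phiC.
have psiNC := class_C_comp oU N_R2 NC psiC.
have t1 := class_C_scale oU phiNC (ipC L2 L3).
have t2 := class_C_scale oU psiNC
  (class_C_bilinear oU (bounded_bilinear_scalar_mul R c) (ipC L2 L1) (ipC L1 L3)).
apply: (eq_class_C oU _ (class_CD oU t1 t2)) => p Up.
by rewrite !NE L1E L2E L3E /S (rep p.1.1)// -mulrA.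
Qed.

Lemma norm_sqrt_scale (u : X) r :
  0 < r -> `|u| = 1 -> `|Num.sqrt r *: u| ^+ 2 = r.
Proof.
move=> r0 u1; rewrite normrZ u1 mulr1 ger0_norm ?sqrtr_ge0//.
by rewrite sqr_sqrtr// ltW.
Qed.

(** For a unit vector [u] this curve meets the sphere of squared radius [r] at
    time [r]; along it the functions [phi] and [psi] can be recovered from
    [sigma]. *)
Lemma class_C_curve k (u x : X) (V : set R) : open V -> V `<=` [set r | 0 < r] ->
  class_C k V (fun r => (Num.sqrt r *: u, x, x) : X * X * X).
Proof.
move=> oV Vpos; have rC := class_C_sub Vpos (class_C_rsqrt R k).
have [I IE] := ex_id_blin R.
have sqrtC := class_CM oV (class_C_blin k I oV) rC.
have cC := class_CD oV (class_C_scale oV sqrtC (class_C_cst k ((u, 0), 0) oV))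
  (class_C_cst k ((0, x), x : X) oV).
apply: (eq_class_C oV _ cC) => r /Vpos r0; rewrite IE.
have -> : r * rsqrt r = Num.sqrt r.
  have s0 : Num.sqrt r != 0 by rewrite gt_eqF// sqrtr_gt0.
  by rewrite /rsqrt -{1}(sqr_sqrtr (ltW r0)) expr2 mulfK.
rewrite -[LHS]/(Num.sqrt r *: u + 0, Num.sqrt r *: 0 + x, Num.sqrt r *: 0 + x).
by rewrite !scaler0 addr0 !add0r.
Qed.

Lemma ex_unit_vector r : sqr_norms G r -> exists u : X, `|u| = 1.
Proof.
case=> g Gg _; have ng : `|g| != 0 by rewrite normr_eq0 (G_neq0 G0).
by exists (`|g|^-1 *: g); rewrite normrZ normfV normr_id mulVf.
Qed.

Lemma open_sqr_norms : open (sqr_norms G).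
Proof.
have oP : open [set r : R | 0 < r] by exact: open_gt.
rewrite openE => r Gr; have r0 := sqr_norms_gt0 G0 Gr.
have [u u1] := ex_unit_vector Gr.
have := class_C_continuous (class_C_curve 0 u 0 oP (@subset_refl _ _)) r0.
have [L1 [_ [_ [L1E _ _]]]] := ex_proj_blin.
move=> /(@continuous_comp _ _ _ _ L1 r) /(_ (@continuous_blin _ _ _ L1 _)) cc.
have : nbhs (Num.sqrt r *: u) G.
  apply: open_nbhs_nbhs; split=> //; apply/(sqr_normsP Ginv).
  by rewrite norm_sqrt_scale.
move=> nG; have := cc G; rewrite /= L1E => /(_ nG) nG'.
have nP : nbhs r [set r : R | 0 < r] by apply: open_nbhs_nbhs; split.
near=> q.
have q0 : 0 < q by near: q.
rewrite -(norm_sqrt_scale q0 u1); apply/(sqr_normsP Ginv).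
have -> : Num.sqrt q *: u = L1 (Num.sqrt q *: u, 0, 0) by rewrite L1E.
by near: q.
Unshelve. all: by end_near. Qed.

(** With [u] a unit vector, [sigma] at [(sqrt r *: u, u, u)] is [phi r + r psi r],
    and at [(sqrt r *: u, e, e)] with [e] orthogonal to [u] it is
    [phi r * `|e| ^+ 2]. Both are C^k in [r], and [r > 0] allows to solve for
    [psi]. On a line there is no [e], and [psi = 0] on [sqr_norms G]. *)
Lemma represents_class_C k phi psi : represents G sigma phi psi ->
  (one_dimensional H -> forall r, sqr_norms G r -> psi r = 0) ->
  class_C k U S ->
  class_C k (sqr_norms G) (phi : R -> R^o) /\
  class_C k (sqr_norms G) (psi : R -> R^o).
Proof.
move=> rep psi0 SC; have oR := open_sqr_norms.
have Rpos : sqr_norms G `<=` [set r | 0 < r] by move=> r /(sqr_norms_gt0 G0).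
have [[r1 Gr1]|nR] := pselect (exists r, sqr_norms G r); last first.
  have R0 : sqr_norms G `<=` set0 by move=> r Gr; apply: nR; exists r.
  have C0 (f : R -> R^o) : class_C k (sqr_norms G) f.
    apply: (eq_class_C oR (f := fun=> 0)); first by move=> r /R0.
    exact: class_C_cst.
  by split.
have [u u1] := ex_unit_vector Gr1.
have u0 : u != 0 by rewrite -(normr_eq0 u) u1 oner_eq0.
have Gu r : sqr_norms G r -> G (Num.sqrt r *: u).
  by move=> Gr; apply/(sqr_normsP Ginv); rewrite norm_sqrt_scale//; exact: Rpos.
have [Re ReE] := ex_sRe_blin R c.
have SxC (x : X) : class_C k (sqr_norms G)
    (fun r => Re (sigma (Num.sqrt r *: u : X) x x)).
  apply: class_C_blin_comp => //.
  have curveU r : sqr_norms G r -> U (Num.sqrt r *: u, x, x) by exact: Gu.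
  exact: (class_C_comp oR curveU (class_C_curve k u x oR Rpos) SC).
have ipuu : ip u u = of_real c 1 by rewrite ip_real u1 expr1n.
have ipsu r : ip u (Num.sqrt r *: u) = of_real c (Num.sqrt r).
  by rewrite [LHS]ipZr sconj_real ipuu rmorph1 mulr1.
have radC : class_C k (sqr_norms G) (fun r => phi r + r * psi r : R^o).
  apply: (eq_class_C oR _ (SxC u)) => r Gr; have r0 := Rpos _ Gr.
  rewrite ReE rep; last exact: Gu.
  rewrite norm_sqrt_scale// ipuu ipsu [ip (_ *: _) u]ipC ipsu sconj_real.
  rewrite -mulrA -!rmorphM -rmorphD of_realK mulr1 -expr2.
  by rewrite sqr_sqrtr ?ltW// mulrC.
have [dim1|[e e0 eg]] := one_dimensional_or_orth ip u0.
  have psi0' := psi0 dim1.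
  split.
    by apply: (eq_class_C oR _ radC) => r Gr; rewrite psi0' ?mulr0 ?addr0.
  apply: (eq_class_C oR (f := fun=> 0)); first by move=> r /psi0'.
  exact: class_C_cst.
have phiC : class_C k (sqr_norms G) (phi : R -> R^o).
  have eC := class_CM oR (class_C_cst k (`|e : X| ^- 2 : R^o) oR) (SxC e).
  apply: (eq_class_C oR _ eC) => r Gr; have r0 := Rpos _ Gr.
  have eu : ip e (Num.sqrt r *: u) = 0 by rewrite [LHS]ipZr eg mulr0.
  rewrite ReE (represents_orth rep (Gu r Gr) eu) norm_sqrt_scale// ip_real -rmorphM.
  by rewrite of_realK mulrC mulfK// expf_neq0// normr_eq0.
split=> //.
have rC := class_C_sub Rpos (class_C_rsqrt R k).
have NphiC := class_CM oR (class_C_cst k (-1 : R^o) oR) phiC.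
have := class_CM oR (class_CD oR radC NphiC) (class_CM oR rC rC).
apply: eq_class_C => // r Gr; have r0 := Rpos _ Gr.
have -> : rsqrt r * rsqrt r = r^-1.
  by rewrite /rsqrt -expr2 exprVn sqr_sqrtr ?ltW.
by field; rewrite gt_eqF.
Qed.

Lemma represents_smoothness phi psi : represents G sigma phi psi ->
  (one_dimensional H -> forall r, sqr_norms G r -> psi r = 0) ->
  smoothness_criterion G sigma phi psi.
Proof.
move=> rep psi0; apply: smoothness_min => k.
split; first exact: represents_class_C.
by case; exact: class_C_represents.
Qed.

End SmoothnessOfForm.

Theorem proposition2p8 (R : realType) (c : scalar_kind)
    (H : lmodType (scalar_field R c)) (ip : {dot H for @sconj R c})
    (G : set (ip_space ip)) (sigma : H -> H -> H -> scalar_field R c) :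
  isometry_invariant_set G -> open G -> ~ G 0 ->
  (forall g : H, G g -> conj_symmetric_sesquilinear (sigma g)) ->
  [/\ isometry_invariant G sigma <->
        (exists phi psi : R -> R, represents G sigma phi psi),
      isometry_invariant G sigma ->
        (exists phi psi : R -> R,
          [/\ represents G sigma phi psi,
              positivity_criterion G sigma phi psi &
              smoothness_criterion G sigma phi psi])
    & ~ one_dimensional H ->
      forall phi psi : R -> R, represents G sigma phi psi ->
        [/\ (forall phi' psi' : R -> R, represents G sigma phi' psi' ->
              forall r : R, sqr_norms G r -> phi' r = phi r /\ psi' r = psi r),
            positivity_criterion G sigma phi psi &
            smoothness_criterion G sigma phi psi]].
Proof.
move=> Ginv Gopen G0 sesq; split.
- split=> [inv|[phi [psi]]]; last exact: represents_invariant.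
  by have [phi [psi [rep _]]] := invariant_represents Ginv G0 sesq inv;
    exists phi, psi.
- move=> inv; have [phi [psi [rep psi0]]] := invariant_represents Ginv G0 sesq inv.
  exists phi, psi; split=> //; first exact: represents_positivity.
  exact: represents_smoothness.
- move=> dim2 phi psi rep; split.
  + by move=> phi' psi' rep'; exact: (represents_unique G0 dim2 rep rep').
  + exact: represents_positivity.
  + exact: represents_smoothness.
Qed.
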